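(* Suppose the following statement (C) holds. (C): Let $q=p^n$ be a power of a prime $p$, $k$ a divisor of $n$, and $v\ge1$ a divisor of $p^k-1$. Let $\mathcal{U}\subseteq\mathbb{F}_q$ be an $\mathbb{F}_{p^k}$-vector space of dimension $m$ such that $1\in\mathcal{U}$ and $\#\mathcal{U}^v>2$. If $\mathcal{U}$ is not a field, then $\mathcal{P}(\mathcal{U}^v,q)=\{f^v : f\in\mathcal{P}(\mathcal{U},q)\}$. Otherwise, $\mathcal{P}(\mathcal{U}^v,q)=\left\{f^{\frac{(p^e-1)v}{p^{mk}-1}} : f\in\mathcal{P}(\mathbb{F}_{p^e},q)\right\}$, where $\mathbb{F}_{p^e}\subseteq\mathbb{F}_q$ is the smallest field containing $\mathcal{U}^v$. Let $q=p^n$ be a prime power, and let $\mathcal{F}: y^d=f(x)$ be an irreducible plane curve defined over the finite field $\mathbb{F}_q$. If $d<q-1$, then $\mathcal{F}$ is $\mathbb{F}_q$-Frobenius nonclassical if and only if $d=\frac{q-1}{p^e-1}$, where $e\mid n$, and $f(x)$ is a minimal value set polynomial (over $\mathbb{F}_q$) whose value set is $\mathbb{F}_{p^e}$.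
   Context: For $F\in\mathbb{F}_q[x]$, $V_F=\{F(\alpha):\alpha\in\mathbb{F}_q\}$ is its value set. A polynomial $F\in\mathbb{F}_q[x]$ of positive degree is a minimal value set polynomial (MVSP) over $\mathbb{F}_q$ if $\#V_F=\lfloor (q-1)/\deg F\rfloor+1$. For a nonempty $S\subseteq\mathbb{F}_q$, $\mathcal{P}(S,q)$ denotes the set of all MVSPs $F\in\mathbb{F}_q[x]$ with $V_F=S$, and $S^v=\{s^v:s\in S\}$ for every integer $v\ge1$. An irreducible plane curve $\mathcal{C}$ defined over $\mathbb{F}_q$ is called $\mathbb{F}_q$-Frobenius nonclassical if the $\mathbb{F}_q$-Frobenius map (raising coordinates to the $q$-th power) takes each nonsingular point $P\in\mathcal{C}$ to the tangent line to $\mathcal{C}$ at $P$.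
   Formalization: It is assumed that d ≥ 1 and f is nonconstant: if f is a constant c, irreducibility forces d = 1 and the line y = c is Frobenius nonclassical although a constant is not a minimal value set polynomial; for d = 0 the equivalence fails likewise. *)

(* Defs.v *)
From HB Require Import structures.
From mathcomp Require Import all_boot all_order all_algebra all_field.
From mathcomp.multinomials Require Import mpoly.

Set Implicit Arguments.
Unset Strict Implicit.
Unset Printing Implicit Defensive.

Import GRing.Theory.
Local Open Scope ring_scope.

Section MinimalValueSets.
Variable F : finFieldType.

Definition value_set (f : {poly F}) : {set F} := [set f.[a] | a : F].

(* (size f).-1 is deg f *)
Definition is_MVSP (f : {poly F}) : Prop :=
  (1 < size f)%N /\ #|value_set f| = ((#|F| - 1) %/ (size f).-1 + 1)%N.

(* f \in P(S, q), where q = #|F| *)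
Definition MVSP_with (S : {set F}) (f : {poly F}) : Prop :=
  is_MVSP f /\ value_set f = S.

Definition set_pow (S : {set F}) (v : nat) : {set F} := [set s ^+ v | s in S].

Definition is_subfield (K : {set F}) : Prop := GRing.divring_closed K.

(* K = F_{p^e} inside F; a finite field has at most one subfield of a given
   order. *)
Definition is_subfield_of_order (N : nat) (K : {set F}) : Prop :=
  is_subfield K /\ #|K| = N.

Definition is_smallest_subfield (S E : {set F}) : Prop :=
  [/\ is_subfield E, S \subset E &
      forall E' : {set F}, is_subfield E' -> S \subset E' -> E \subset E'].

(* U is the K-span of a K-linearly independent family of length m *)
Definition is_subspace_of_dim (K U : {set F}) (m : nat) : Prop :=
  exists b : m.-tuple F,
    (forall c : {ffun 'I_m -> F}, c \in ffun_on K ->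
       \sum_(i < m) c i * tnth b i = 0 -> forall i, c i = 0) /\
    (forall u : F, u \in U <->
       exists2 c : {ffun 'I_m -> F}, c \in ffun_on K &
         u = \sum_(i < m) c i * tnth b i).

End MinimalValueSets.

Definition condition_C : Prop :=
  forall (F : finFieldType) (p n k v m : nat) (K U : {set F}),
    prime p -> #|F| = (p ^ n)%N -> (k %| n)%N ->
    (1 <= v)%N -> (v %| p ^ k - 1)%N ->
    is_subfield_of_order (p ^ k) K ->
    is_subspace_of_dim K U m ->
    1 \in U -> (2 < #|set_pow U v|)%N ->
    (~ is_subfield U ->
       forall g : {poly F}, MVSP_with (set_pow U v) g <->
         exists2 f, MVSP_with U f & g = f ^+ v) /\
    (is_subfield U ->
       forall (e : nat) (E : {set F}),
         is_smallest_subfield (set_pow U v) E -> #|E| = (p ^ e)%N ->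
         forall g : {poly F}, MVSP_with (set_pow U v) g <->
           exists2 f, MVSP_with E f &
             g = f ^+ (((p ^ e - 1) * v) %/ (p ^ (m * k) - 1))).

(* A projective plane curve is given by its defining form in three variables,
   a point by its homogeneous coordinates. *)

Definition irreducible_mpoly (n : nat) (K : fieldType) (G : {mpoly K[n]})
    : Prop :=
  [/\ G != 0, G \isn't a GRing.unit &
      forall A B : {mpoly K[n]}, G = A * B ->
        A \is a GRing.unit \/ B \is a GRing.unit].

Definition nonsingular_point (K : fieldType) (G : {mpoly K[3]})
    (P : 'I_3 -> K) : Prop :=
  [/\ exists i, P i != 0, G.@[P] = 0 & exists i, (G^`M(i)).@[P] != 0].

Definition on_tangent_line (K : fieldType) (G : {mpoly K[3]})
    (P Q : 'I_3 -> K) : Prop :=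
  \sum_(i < 3) (G^`M(i)).@[P] * Q i = 0.

(* K, with embedding iota, is meant to be an algebraic closure of F; the points
   of the curve have their coordinates in K. *)
Definition Frobenius_nonclassical (F : finFieldType) (K : closedFieldType)
    (iota : {rmorphism F -> K}) (G : {mpoly F[3]}) : Prop :=
  forall P : 'I_3 -> K,
    nonsingular_point (map_mpoly iota G) P ->
    on_tangent_line (map_mpoly iota G) P (fun i => P i ^+ #|F|).

(* The homogenization, of degree max (d, deg f), of y^d - f(x), in the
   coordinates (x : y : z). *)
Definition y_pow_eq_form (F : fieldType) (d : nat) (f : {poly F})
    : {mpoly F[3]} :=
  let x := 'X_(@Ordinal 3 0 isT) in
  let y := 'X_(@Ordinal 3 1 isT) in
  let z := 'X_(@Ordinal 3 2 isT) in
  let N := maxn d (size f).-1 in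
  y ^+ d * z ^+ (N - d) - \sum_(i < size f) f`_i *: (x ^+ i * z ^+ (N - i)).

(* Main.v *)
(** Substituting y^d = f(x) into the tangency condition at the affine points shows
    that the curve is Frobenius nonclassical exactly when d divides q - 1 and
      d f (f^t - 1) = f' (x^q - x),   t = (q - 1)/d,
    where d is prime to p since the curve is not a p-th power.  This identity forces
    V_f to be the set of t + 1 roots of X^(t+1) - X, that is, the set of d-th powers
    of F_q, and makes f an MVSP.  Condition (C) with U = F_q then gives f = g^w with
    V_g = F_(p^e) and p^e - 1 = w t; as w divides d, irreducibility forces w = 1.
    Conversely, if V_f = F_N with N = p^e, then f^N - f = h (x^q - x), and minimality
    bounds the degree of h so that differentiating gives h = f'; this is the identity
    above since d = 1 in F_q. *)

Require Import Defs.
From mathcomp Require Import all_boot all_order all_algebra all_field.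
From mathcomp.multinomials Require Import mpoly.
From mathcomp Require Import all_fingroup ring zify.

Import GRing.Theory.
Local Open Scope ring_scope.

(** * Subfields and roots in finite fields *)

Section FiniteField.
Context {F : finFieldType}.
Implicit Types (f : {poly F}) (S E : {set F}).

Lemma card_roots_lt {f S} : f != 0 -> {in S, forall a, root f a} -> (#|S| < size f)%N.
Proof.
move=> f0 Sf; rewrite cardE; apply: max_poly_roots (enum_uniq _) => //.
by apply/allP => a; rewrite mem_enum => /Sf.
Qed.

(** Each fibre of [f] consists of roots of some [f - y%:P], hence has at most deg f points; summing
    over the values bounds q by [#|value_set f|] times deg f. *)
Lemma card_value_set_ge {f} : (1 < size f)%N ->
  ((#|F| - 1) %/ (size f).-1 + 1 <= #|value_set f|)%N.
Proof.
move=> f1; have D0 : (0 < (size f).-1)%N by lia.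
have le_q : (#|F| <= #|value_set f| * (size f).-1)%N.
  rewrite -sum_nat_const -sum1_card.
  rewrite (partition_big (horner f) (mem (value_set f))) /=; last first.
    by move=> a _; apply: imset_f.
  apply: leq_sum => y _; rewrite sum1dep_card.
  rewrite -ltnS (prednK (ltnW f1)).
  have szf : size (f - y%:P) = size f.
    by rewrite size_polyDl // size_polyN size_polyC (leq_ltn_trans (leq_b1 _)).
  rewrite -szf; apply: card_roots_lt => [|a].
    by rewrite -size_poly_gt0 szf; lia.
  by rewrite inE /= /root !hornerE subr_eq0.
have q0 : (0 < #|F|)%N by apply/card_gt0P; exists 0.
by rewrite addn1 ltn_divLR //; lia.
Qed.

Lemma leq_card_unity_roots {m S} : (0 < m)%N ->
  {in S, forall a, a ^+ m = 1} -> (#|S| <= m)%N.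
Proof.
move=> m0 Sm; rewrite -ltnS -(size_XnsubC (1 : F) m0).
apply: card_roots_lt => [|a /Sm am]; first by rewrite -size_poly_gt0 size_XnsubC.
by rewrite /root !hornerE ?hornerXn am subrr.
Qed.

Lemma leq_card_expf_fixed {m S} : (0 < m)%N ->
  {in S, forall a, a ^+ m.+1 = a} -> (#|S| <= m.+1)%N.
Proof.
move=> m0 Sm; rewrite (cardsD1 0) -add1n leq_add ?leq_b1 //.
apply: leq_card_unity_roots => // a; rewrite !inE => /andP[a0 /Sm aS].
by apply: (mulfI a0); rewrite -exprS mulr1.
Qed.

(* [m %% #|S|] is again an exponent killing [S], but [S] has more elements than
   that. *)
Lemma dvdn_card_unity_roots m {S} : (0 < #|S|)%N ->
  {in S, forall a, a ^+ #|S| = 1} -> {in S, forall a, a ^+ m = 1} ->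
  (#|S| %| m)%N.
Proof.
move=> S0 SS Sm; rewrite /dvdn; case: posnP => // r0.
have /(leq_card_unity_roots r0) : {in S, forall a, a ^+ (m %% #|S|) = 1}.
  move=> a aS; move: (Sm _ aS).
  by rewrite {1}(divn_eq m #|S|) exprD mulnC exprM SS // expr1n mul1r.
by rewrite leqNgt ltn_mod S0.
Qed.

Section Subfield.
Context {E : {set F}}.
Hypothesis fieldE : is_subfield E.

Lemma subfield1 : 1 \in E. Proof. by case: fieldE. Qed.

Lemma subfieldB : {in E &, forall a b, a - b \in E}. Proof. by case: fieldE. Qed.

Lemma subfield_div : {in E &, forall a b, a / b \in E}.
Proof. by case: fieldE. Qed.

Lemma subfield0 : 0 \in E.
Proof. by rewrite -(subrr 1) subfieldB ?subfield1. Qed.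

Lemma subfieldD : {in E &, forall a b, a + b \in E}.
Proof. by move=> a b aE bE; rewrite -(opprK b) -(sub0r b) !subfieldB ?subfield0. Qed.

Lemma subfieldM : {in E &, forall a b, a * b \in E}.
Proof.
by move=> a b aE bE; rewrite -(invrK b) -(div1r b) !subfield_div ?subfield1.
Qed.

Lemma card_subfieldD0 : #|E :\ 0| = (#|E| - 1)%N.
Proof. by rewrite (cardsD1 0 E) subfield0 addKn. Qed.

(* Multiplication by [a] permutes the nonzero elements of [E]. *)
Lemma subfield_expf_card a : a \in E :\ 0 -> a ^+ (#|E| - 1) = 1.
Proof.
rewrite !inE => /andP[a0 aE]; rewrite -card_subfieldD0.
have P0 : \prod_(b in E :\ 0) b != 0.
  by apply/prodf_neq0 => b; rewrite !inE => /andP[].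
apply: (mulIf P0); rewrite mul1r {2}(reindex_inj (mulfI a0)) /=.
rewrite -prodr_const -big_split /=; apply: eq_bigl => b.
rewrite !inE mulf_eq0 (negPf a0) /=; congr (_ && _); apply/idP/idP => [|bE].
  exact: subfieldM.
by rewrite -(mulKf a0 b) mulrC subfield_div.
Qed.

Lemma subfield_card_gt1 : (1 < #|E|)%N.
Proof.
by rewrite (cardsD1 0) subfield0 (cardsD1 1) !inE oner_eq0 subfield1.
Qed.

Lemma subfield_expf_fixed a : a \in E -> a ^+ #|E| = a.
Proof.
move=> aE; have [->|a0] := eqVneq a 0.
  by rewrite expr0n gtn_eqF // (ltnW subfield_card_gt1).
rewrite -(subnK (ltnW subfield_card_gt1)) addn1 exprS subfield_expf_card ?mulr1 //.
by rewrite !inE a0.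
Qed.

(** Lagrange's theorem for the additive group of [E] inside that of [F]. *)
Lemma card_subfield {p n} : prime p -> #|F| = (p ^ n)%N ->
  exists e, #|E| = (p ^ e)%N.
Proof.
move=> pp cF.
have gE : group_set E.
  by apply/group_setP; split; [exact: subfield0 | exact: subfieldD].
have : (#|E| %| p ^ n)%N.
  by rewrite -cF -cardsT; apply: (cardSg (H := group gE)); apply: subsetT.
by case/(dvdn_pfactor _ _ pp) => e _ ->; exists e.
Qed.

End Subfield.

Lemma is_subfieldT : is_subfield [set: F].
Proof. by split=> [|a b _ _|a b _ _]; rewrite inE. Qed.

(** Condition (C) takes the smallest subfield as given, so one has to be produced. The boolean [b]
    restates [is_subfield] so that it can index a finite intersection. *)
Lemma smallest_subfield_exists S : exists E, is_smallest_subfield S E.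
Proof.
pose b (E : {set F}) :=
  [&& 1 \in E, [forall x in E, forall y in E, x - y \in E]
    & [forall x in E, forall y in E, x / y \in E]].
have bP E : reflect (is_subfield E) (b E).
  apply: (iffP and3P) => -[E1 EB Ed]; split=> //.
  - by move=> x y xE yE; move/forall_inP/(_ _ xE)/forall_inP/(_ _ yE): EB.
  - by move=> x y xE yE; move/forall_inP/(_ _ xE)/forall_inP/(_ _ yE): Ed.
  - by apply/forall_inP=> x xE; apply/forall_inP=> y yE; apply: EB.
  - by apply/forall_inP=> x xE; apply/forall_inP=> y yE; apply: Ed.
exists (\bigcap_(E | b E && (S \subset E)) E); split.
- split; first by apply/bigcapP => E /andP[/bP fE _]; apply: subfield1.
    move=> x y /bigcapP xE /bigcapP yE; apply/bigcapP => E bE.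
    by case/andP: (bE) => /bP fE _; rewrite subfieldB ?xE ?yE.
  move=> x y /bigcapP xE /bigcapP yE; apply/bigcapP => E bE.
  by case/andP: (bE) => /bP fE _; rewrite subfield_div ?xE ?yE.
- by apply/bigcapsP => E /andP[].
- by move=> E /bP bE SE; apply: bigcap_inf; rewrite bE.
Qed.

End FiniteField.

(** * Minimal value set polynomials *)

Section ValueSets.
Context {F : finFieldType}.
Local Notation q := #|F|.

Lemma finField_card_gt1 : (1 < q)%N.
Proof. exact: finNzRing_gt1. Qed.

Lemma expf_pred_card {a : F} : a != 0 -> a ^+ (q - 1) = 1.
Proof.
move=> a0; rewrite -cardsT; apply: (subfield_expf_card is_subfieldT).
by rewrite !inE a0.
Qed.

Lemma size_genPoly : size ('X^q - 'X : {poly F}) = q.+1.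
Proof.
by rewrite size_polyDl ?size_polyXn // size_polyN size_polyX ltnS finField_card_gt1.
Qed.

Lemma size_mul_genPoly {h : {poly F}} : h != 0 ->
  size (h * ('X^q - 'X)) = (size h + q)%N.
Proof.
move=> h0; rewrite size_Mmonic // ?size_genPoly ?addnS //.
by rewrite finField_genPoly monic_prod_XsubC.
Qed.

Lemma genPoly_factor {f : {poly F}} : (forall a, root f a) ->
  exists h : {poly F}, f = h * ('X^q - 'X).
Proof.
move=> f0; apply/dvdpP; rewrite finField_genPoly -[index_enum F]enumT.
by apply: uniq_roots_dvdp; [apply/allP => a _ | rewrite uniq_rootsE enum_uniq].
Qed.

Lemma MVSP_subfield_degree {f : {poly F}} : is_MVSP f ->
  ((#|value_set f| - 1) * (size f).-1 <= q - 1)%N.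
Proof. by case=> _ ->; rewrite addnK leq_divM. Qed.

(* Writing [f ^+ N - f = h * ('X^q - 'X)], minimality bounds [deg h] by
   [deg f - 1 < q]; differentiating, [h - f' = h' * ('X^q - 'X)] forces [h' = 0]. *)
Lemma MVSP_subfield_identity {p n} {f : {poly F}} :
  prime p -> q = (p ^ n)%N -> is_MVSP f -> is_subfield (value_set f) ->
  f ^+ #|value_set f| - f = f^`() * ('X^q - 'X).
Proof.
move=> p_prime card_F mf fE; set N := #|value_set f|; set D := (size f).-1.
have [sf _] := mf.
have ND : ((N - 1) * D <= q - 1)%N := MVSP_subfield_degree mf.
have N1 : (1 < N)%N := subfield_card_gt1 fE.
have {ND} DN : (D * N <= q - 1 + D)%N by nia.
have q1 := finField_card_gt1.
have f_neq0 : f != 0 by rewrite -size_poly_gt0 (ltnW sf).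
have szfD : size f = D.+1 by rewrite /D prednK // (ltnW sf).
have D0 : (0 < D)%N by rewrite -ltnS -szfD.
have [e Ne] := card_subfield fE p_prime card_F.
have cp : p \in [pchar F] := card_finPcharP card_F p_prime.
(* [N] is a power of p greater than 1, so it vanishes in characteristic p. *)
have N0 : N%:R = 0 :> {poly F}.
  rewrite /N Ne; move: N1; rewrite /N Ne; case: e {Ne} => [|e _] //.
  by rewrite natrX -polyC_natr (pcharf0 cp) expr0n.
have q0 : q%:R = 0 :> {poly F}.
  move: q1; rewrite card_F; case: n {card_F} => [|k] //.
  by rewrite natrX -polyC_natr (pcharf0 cp) expr0n.
have [h hE] : exists h : {poly F}, f ^+ N - f = h * ('X^q - 'X).
  apply: genPoly_factor => a; rewrite /root !hornerE subr_eq0.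
  by rewrite (subfield_expf_fixed fE) // imset_f.
have dh : - f^`() = h^`() * ('X^q - 'X) - h.
  have := congr1 (@deriv F) hE.
  rewrite derivM !derivB derivX derivXn -mulr_natr q0 mulr0 sub0r mulrN1.
  by rewrite deriv_exp -mulr_natr N0 mulr0 sub0r.
have szh : (size h <= D)%N.
  have [->|h0] := eqVneq h 0; first by rewrite size_poly0.
  have szf : size (f ^+ N - f) = (D * N).+1.
    have szfN : size (f ^+ N) = (D * N).+1.
      by rewrite -[LHS]prednK ?size_exp // size_poly_gt0 expf_neq0.
    by rewrite size_polyDl // size_polyN szfN szfD; nia.
  by rewrite -(leq_add2r q) -size_mul_genPoly // -hE szf; lia.
have dh0 : h^`() = 0.
  apply/eqP; apply: contraT => h0.
  have : (size (h^`() * ('X^q - 'X))%R <= D)%N.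
    have -> : h^`() * ('X^q - 'X) = h - f^`() by rewrite dh; ring.
    rewrite (leq_trans (size_polyD _ _)) // geq_max szh size_polyN.
    by rewrite -ltnS -szfD lt_size_deriv.
  by rewrite size_mul_genPoly // leqNgt (leq_trans _ (leq_addl _ _)) //; nia.
by rewrite hE; move: dh; rewrite dh0 mul0r sub0r => /oppr_inj->.
Qed.

(** Both sets lie among the at most t + 1 roots of X^(t+1) - X and both are large enough to fill
    them: [S] by hypothesis, the d-th powers by [card_value_set_ge] applied to ['X^d]. *)
Lemma set_pow_eq_fixed {d t} {S : {set F}} : (0 < t)%N -> (d * t = q - 1)%N ->
  {in S, forall a, a ^+ t.+1 = a} -> (t < #|S|)%N -> S = set_pow [set: F] d.
Proof.
move=> t0 dt St cS; have q1 := finField_card_gt1.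
have d0 : (0 < d)%N by nia.
pose Fx := [set a : F | a ^+ t.+1 == a].
have cFx : (#|Fx| <= t.+1)%N.
  by apply: leq_card_expf_fixed => // a; rewrite inE => /eqP.
have -> : S = Fx.
  apply/eqP; rewrite eqEcard (leq_trans cFx) // andbT.
  by apply/subsetP => a /St; rewrite inE => ->.
apply/esym/eqP; rewrite eqEcard; apply/andP; split.
  apply/subsetP => _ /imsetP[a _ ->]; rewrite inE -exprM mulnS dt.
  have [->|a0] := eqVneq a 0; first by rewrite !expr0n; case: (d) d0.
  by rewrite exprD expf_pred_card ?mulr1.
have sX : (1 < size ('X^d : {poly F}))%N by rewrite size_polyXn.
rewrite (leq_trans cFx) //.
have -> : set_pow [set: F] d = value_set 'X^d.
  apply/setP => b; apply/imsetP/imsetP => -[a _ ->]; exists a => //.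
    by rewrite hornerXn.
  by rewrite hornerXn.
apply: leq_trans (card_value_set_ge sX); rewrite size_polyXn /= -dt mulKn //.
by rewrite addn1.
Qed.

(** The right-hand side vanishes on [F], so every value b of [f] satisfies b^(t+1) = b and there are
    at most t + 1 values. Comparing degrees gives t deg f <= q - 1, and then [card_value_set_ge]
    gives at least t + 1 values. Equality in both bounds is minimality. *)
Lemma MVSP_of_identity {d t} {f : {poly F}} :
  (1 < size f)%N -> (0 < t)%N -> (d * t = q - 1)%N -> d%:R != 0 :> F ->
  d%:R *: (f * (f ^+ t - 1)) = f^`() * ('X^q - 'X) ->
  MVSP_with (set_pow [set: F] d) f /\ #|set_pow [set: F] d| = t.+1.
Proof.
move=> sf t0 dt d0 fE; set D := (size f).-1; have q1 := finField_card_gt1.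
have fixV : {in value_set f, forall b, b ^+ t.+1 = b}.
  move=> _ /imsetP[a _ ->]; have := congr1 (horner^~ a) fE.
  rewrite /= !hornerE expf_card subrr mulr0 => /eqP.
  rewrite !mulf_eq0 (negPf d0) /= => /orP[/eqP->|].
    by rewrite expr0n.
  by rewrite subr_eq0 exprS => /eqP->; rewrite mulr1.
have f_neq0 : f != 0 by rewrite -size_poly_gt0 (ltnW sf).
have szfD : size f = D.+1 by rewrite /D prednK // (ltnW sf).
have D0 : (0 < D)%N by rewrite -ltnS -szfD.
have tD : (t * D <= q - 1)%N.
  have szL : size (d%:R *: (f * (f ^+ t - 1))) = (D * t.+1).+1.
    have szft : size (f ^+ t) = (D * t).+1.
      by rewrite -[LHS]prednK ?size_exp // size_poly_gt0 expf_neq0.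
    have szft1 : size (f ^+ t - 1) = (D * t).+1.
      by rewrite size_polyDl // size_polyN size_poly1 szft; nia.
    have ft1 : f ^+ t - 1 != 0 by rewrite -size_poly_gt0 szft1.
    by rewrite size_scale // size_mul // szft1 szfD addSn addnS mulnS.
  have := congr1 (fun r : {poly F} => size r) fE; rewrite /= szL.
  (* A zero derivative would force the left-hand side, of positive size, to vanish. *)
  have [->|df0] := eqVneq f^`() 0; first by rewrite mul0r size_poly0.
  rewrite size_mul_genPoly // => szE.
  have : (size f^`() <= D)%N by rewrite -ltnS -szfD lt_size_deriv.
  rewrite -(leq_add2r q) -szE mulnS (mulnC D) ltn_add2l => tDq.
  by rewrite leq_subRL ?(ltnW q1).
have tle : (t <= (q - 1) %/ D)%N by rewrite leq_divRL.
have geV := card_value_set_ge sf; rewrite -/D in geV.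
have leV := leq_card_expf_fixed t0 fixV.
have cV : #|value_set f| = t.+1 by lia.
have VE : value_set f = set_pow [set: F] d.
  by apply: (@set_pow_eq_fixed d t) => //; rewrite cV.
split; last by rewrite -VE.
by split=> //; split=> //; rewrite -/D; lia.
Qed.

Lemma is_subspaceT : is_subspace_of_dim [set: F] [set: F] 1.
Proof.
exists [tuple 1]; split.
  by move=> c _; rewrite big_ord1 mulr1 => c0 i; rewrite ord1.
move=> u; rewrite inE; split=> // _; exists [ffun=> u].
  by apply/ffun_onP => i; rewrite inE.
by rewrite big_ord1 ffunE mulr1.
Qed.

(** Condition (C) is applied with [U] and [K] both equal to [F], k = n, m = 1 and v = d; [1 < t]
    provides more than two d-th powers. As [F] is a field, the second case of (C) applies and gives
    w = (p^e - 1) d / (q - 1). *)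
Lemma power_of_MVSP_subfield {p n d t} {f : {poly F}} : condition_C ->
  prime p -> q = (p ^ n)%N ->
  (1 < t)%N -> (d * t = q - 1)%N -> (1 < size f)%N ->
  MVSP_with (set_pow [set: F] d) f -> #|set_pow [set: F] d| = t.+1 ->
  exists e (g : {poly F}) (w : nat),
    [/\ is_MVSP g, is_subfield_of_order (p ^ e) (value_set g), f = g ^+ w,
        (d * (p ^ e - 1) = w * (q - 1))%N & (p ^ e - 1 %| q - 1)%N].
Proof.
move=> HC p_prime card_F t1 dt sf mf ct; have q1 := finField_card_gt1.
have d0 : (0 < d)%N by nia.
have [E EP] := smallest_subfield_exists (set_pow [set: F] d).
have [fE SE _] := EP; have [e cE] := card_subfield fE p_prime card_F.
have d_dvd : (d %| p ^ n - 1)%N by rewrite -card_F -dt dvdn_mulr.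
have orderF : is_subfield_of_order (p ^ n) [set: F].
  by split; [exact: is_subfieldT | rewrite cardsT].
have c2 : (2 < #|set_pow [set: F] d|)%N by rewrite ct.
have [_ /(_ is_subfieldT e E EP cE f)[/(_ mf)]] := HC F p n n d 1%N [set: F] [set: F]
  p_prime card_F (dvdnn n) d0 d_dvd orderF is_subspaceT (in_setT 1) c2.
rewrite mul1n -card_F => -[g [mg gE] fg] _.
exists e, g, ((p ^ e - 1) * d %/ (q - 1))%N; split=> //; first by rewrite gE.
  (* The division defining w is exact: nonzero d-th powers lie in [E], so the exponent d (p^e - 1)
     kills all q - 1 nonzero elements of [F]. *)
  rewrite divnK 1?mulnC //.
  have cT : #|[set: F] :\ 0| = (q - 1)%N.
    by rewrite (card_subfieldD0 is_subfieldT) cardsT.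
  have := @dvdn_card_unity_roots F (d * (p ^ e - 1)) ([set: F] :\ 0).
  rewrite cT; apply; first by lia.
    by move=> a; rewrite !inE andbT => /expf_pred_card.
  move=> a a0; rewrite exprM -cE; apply: (subfield_expf_card fE).
  move: a0; rewrite !inE andbT => a0; rewrite expf_neq0 //=.
  by apply: (subsetP SE); apply: imset_f.
(* Likewise, the exponent q - 1 kills the p^e - 1 nonzero elements of [E]. *)
rewrite -cE -(card_subfieldD0 fE).
have E1 := subfield_card_gt1 fE.
apply: dvdn_card_unity_roots; first by rewrite (card_subfieldD0 fE); lia.
  by move=> a; rewrite (card_subfieldD0 fE); apply: (subfield_expf_card fE).
move=> a; rewrite !inE => /andP[a0 _].
exact: expf_pred_card.
Qed.

End ValueSets.

(** * The form of the curve and its partial derivatives *)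

Section Forms.
Variable K : fieldType.
Local Notation o0 := (@Ordinal 3 0 isT).
Local Notation o1 := (@Ordinal 3 1 isT).
Local Notation o2 := (@Ordinal 3 2 isT).
Implicit Types (f : {poly K}) (P : 'I_3 -> K).

Lemma sum_ord3 {V : nmodType} (h : 'I_3 -> V) :
  \sum_(i < 3) h i = h o0 + h o1 + h o2.
Proof.
rewrite !big_ord_recl big_ord0 addr0 addrA.
by congr (h _ + h _ + h _); apply: val_inj.
Qed.

Lemma expf_sub {L : fieldType} {a : L} {m k : nat} : a != 0 -> (k <= m)%N ->
  a ^+ (m - k) = a ^+ m / a ^+ k.
Proof. by move=> a0 km; rewrite -[in RHS](subnK km) exprD mulfK // expf_neq0. Qed.

Lemma mderiv_var n (i j : 'I_n) : ('X_j : {mpoly K[n]})^`M(i) = (j == i)%:R.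
Proof.
rewrite mderivX mnmE; case: eqP => [->|_]; last by rewrite scale0r.
by rewrite scale1r -{1}(add0m U_(i)%MM) addmK mpolyX0.
Qed.

Lemma mderivXn n (i : 'I_n) (g : {mpoly K[n]}) k :
  (g ^+ k)^`M(i) = k%:R * g ^+ k.-1 * g^`M(i).
Proof.
elim: k => [|k IH]; first by rewrite -(@mpolyC1 n K) mderivC !mul0r.
rewrite exprS mderivM IH; case: k {IH} => [|k] /=; first by ring.
by rewrite (exprS _ k) -!natr1; ring.
Qed.

Lemma y_pow_eq_form_map (L : fieldType) (iota : {rmorphism L -> K}) d (f : {poly L}) :
  map_mpoly iota (y_pow_eq_form d f) = y_pow_eq_form d (map_poly iota f).
Proof.
rewrite /y_pow_eq_form rmorphB rmorphM !rmorphXn /= !map_mpolyX size_map_poly.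
congr (_ - _); rewrite rmorph_sum; apply: eq_bigr => i _ /=.
by rewrite map_mpolyZ rmorphM !rmorphXn /= !map_mpolyX coef_map.
Qed.

Lemma horner_deriv f a :
  f^`().[a] = \sum_(i < size f) f`_i * (i%:R * a ^+ i.-1).
Proof.
rewrite -{1}(coefK f) poly_def raddf_sum horner_sum.
by apply: eq_bigr => i _ /=; rewrite derivZ derivXn hornerZ hornerMn hornerXn mulr_natl.
Qed.

Section Partials.
Variables (d : nat) (f : {poly K}) (P : 'I_3 -> K).
Local Notation x := (P o0).
Local Notation y := (P o1).
Local Notation z := (P o2).
Local Notation N := (maxn d (size f).-1).
Local Notation G := (y_pow_eq_form d f).

Lemma meval_form :
  G.@[P] = y ^+ d * z ^+ (N - d) - \sum_(i < size f) f`_i * (x ^+ i * z ^+ (N - i)).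
Proof.
rewrite /y_pow_eq_form mevalB mevalM !rmorphXn /= !mevalXU; congr (_ - _).
rewrite raddf_sum; apply: eq_bigr => i _ /=.
by rewrite mevalZ mevalM !rmorphXn /= !mevalXU.
Qed.

Lemma meval_form_dx :
  (G^`M(o0)).@[P] = - \sum_(i < size f) f`_i * (i%:R * x ^+ i.-1 * z ^+ (N - i)).
Proof.
rewrite /y_pow_eq_form mderivB mderivM !mderivXn !mderiv_var !mulr0 mul0r addr0 sub0r.
rewrite mevalN; congr (- _).
rewrite (raddf_sum (mderiv _)) /= (raddf_sum (meval _)); apply: eq_bigr => i _ /=.
rewrite mderivZ mderivM !mderivXn !mderiv_var !mulr0 addr0 mulr1.
by rewrite mevalZ !mevalM !rmorphXn /= !mevalXU rmorph_nat.
Qed.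

Lemma meval_form_dy : (G^`M(o1)).@[P] = d%:R * y ^+ d.-1 * z ^+ (N - d).
Proof.
rewrite /y_pow_eq_form mderivB mderivM !mderivXn !mderiv_var !mulr0 mulr1 addr0.
rewrite (raddf_sum (mderiv _)) /= big1 => [|i _]; last first.
  by rewrite mderivZ mderivM !mderivXn !mderiv_var !mulr0 mul0r addr0 scaler0.
by rewrite subr0 !mevalM !rmorphXn /= !mevalXU rmorph_nat.
Qed.

Lemma meval_form_dz :
  (G^`M(o2)).@[P] = y ^+ d * ((N - d)%:R * z ^+ (N - d).-1)
    - \sum_(i < size f) f`_i * (x ^+ i * ((N - i)%:R * z ^+ (N - i).-1)).
Proof.
rewrite /y_pow_eq_form mderivB mderivM !mderivXn !mderiv_var !mulr0 mul0r mulr1 add0r.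
rewrite mevalB !mevalM !rmorphXn /= !mevalXU rmorph_nat.
congr (_ - _).
rewrite (raddf_sum (mderiv _)) /= (raddf_sum (meval _)); apply: eq_bigr => i _ /=.
rewrite mderivZ mderivM !mderivXn !mderiv_var !mulr0 mul0r add0r mulr1.
by rewrite mevalZ !mevalM !rmorphXn /= !mevalXU rmorph_nat.
Qed.

(** Checked monomial by monomial through N = i + (N - i) and N = d + (N - d); no subtraction
    truncates, since N is at least d and deg f. *)
Lemma Euler_form :
  x * (G^`M(o0)).@[P] + y * (G^`M(o1)).@[P] + z * (G^`M(o2)).@[P]
  = N%:R * G.@[P].
Proof.
have mulXpred (c : K) k : c * (k%:R * c ^+ k.-1) = k%:R * c ^+ k.
  by case: k => [|k]; rewrite ?mul0r ?mulr0 //= exprS; ring.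
have eN : N%:R = d%:R + (N - d)%:R :> K by rewrite -natrD subnKC ?leq_maxl.
rewrite meval_form meval_form_dx meval_form_dy meval_form_dz.
set Sx := \sum_(i < _) _; set Sz := \sum_(i < _) _; set S := \sum_(i < _) _.
have eS : x * Sx + z * Sz = N%:R * S.
  rewrite /Sx /Sz /S !mulr_sumr -big_split; apply: eq_bigr => i _ /=.
  have leiN : (i <= N)%N by have := ltn_ord i; lia.
  have -> : N%:R = i%:R + (N - i)%:R :> K by rewrite -natrD subnKC.
  have := mulXpred x i; have := mulXpred z (N - i)%N.
  set u := z ^+ (N - i); set v := x ^+ i.
  set u' := z ^+ (N - i).-1; set v' := x ^+ i.-1 => eu ev.
  transitivity (f`_i * (x * (i%:R * v') * u + v * (z * ((N - i)%:R * u')))).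
    by ring.
  by rewrite eu ev; ring.
have := mulXpred y d; have := mulXpred z (N - d)%N.
rewrite [_ * (_ - S)]mulrBr -eS eN.
set u := z ^+ (N - d); set v := y ^+ d.
set u' := z ^+ (N - d).-1; set v' := y ^+ d.-1 => eu ev.
transitivity (- (x * Sx) + y * (d%:R * v') * u + v * (z * ((N - d)%:R * u')) - z * Sz).
  by ring.
by rewrite eu ev; ring.
Qed.
Hypothesis z0 : z != 0.

Lemma leq_degree (i : 'I_(size f)) : (i <= N)%N.
Proof. by have := ltn_ord i; lia. Qed.

Lemma meval_form_affine : G.@[P] = z ^+ N * ((y / z) ^+ d - f.[x / z]).
Proof.
rewrite meval_form horner_coef mulrBr mulr_sumr; congr (_ - _).
  by rewrite exprMn exprVn expf_sub ?leq_maxl //; ring.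
by apply: eq_bigr => i _; rewrite exprMn exprVn expf_sub ?leq_degree //; ring.
Qed.

(** Multiplying by z restores the degree lost by differentiation, so the same power of z factors out
    here, in the y-partial and in the form itself. *)
Lemma meval_form_dx_affine :
  z * (G^`M(o0)).@[P] = - (z ^+ N * f^`().[x / z]).
Proof.
rewrite meval_form_dx horner_deriv mulrN !mulr_sumr; congr (- _).
(* The term of index 0 vanishes through its factor i; it is set apart because [i.-1] truncates
   there. *)
apply: eq_bigr => -[[|i] lti] _ /=; first by rewrite !mul0r !mulr0.
have := leq_degree (Ordinal lti); rewrite /= => leiN.
by rewrite exprMn exprVn -(subnK leiN) addnK exprD exprSr; field; rewrite ?z0 ?expf_neq0.
Qed.

Lemma meval_form_dy_affine :
  z * (G^`M(o1)).@[P] = z ^+ N * (d%:R * (y / z) ^+ d.-1).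
Proof.
rewrite meval_form_dy; case: d (leq_maxl d (size f).-1) => [|k] /= lekN.
  by rewrite !mul0r !mulr0.
by rewrite exprMn exprVn -(subnK lekN) addnK exprD exprSr; field; rewrite ?z0 ?expf_neq0.
Qed.

(* Euler's relation eliminates the partial derivative in z. *)
Lemma tangent_affine q : G.@[P] = 0 ->
  z * \sum_(i < 3) (G^`M(i)).@[P] * P i ^+ q =
  z ^+ q * z ^+ N * (d%:R * (y / z) ^+ d.-1 * ((y / z) ^+ q - y / z)
                     - f^`().[x / z] * ((x / z) ^+ q - x / z)).
Proof.
move=> G0; rewrite sum_ord3.
have := Euler_form; rewrite G0 mulr0.
have := meval_form_dx_affine; have := meval_form_dy_affine.
set Gx := (G^`M(o0)).@[P]; set Gy := (G^`M(o1)).@[P]; set Gz := (G^`M(o2)).@[P].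
move=> eGy eGx eGz.
have ex : x ^+ q = (x / z) ^+ q * z ^+ q by rewrite -exprMn divfK.
have ey : y ^+ q = (y / z) ^+ q * z ^+ q by rewrite -exprMn divfK.
transitivity (z * Gx * (x ^+ q - x / z * z ^+ q) + z * Gy * (y ^+ q - y / z * z ^+ q)
              + z ^+ q * (x * Gx + y * Gy + z * Gz)).
  by field.
by rewrite eGx eGy eGz ex ey; ring.
Qed.
End Partials.

(** If one of the partials in x and y is nonzero at (a : b : 1), the point is nonsingular and this
    is its tangency condition; if both vanish, both sides are 0. The relation thus holds at every
    affine point. *)
Lemma on_curve_tangent d f q :
  (forall P, nonsingular_point (y_pow_eq_form d f) P ->
     on_tangent_line (y_pow_eq_form d f) P (fun i => P i ^+ q)) ->
  forall a b, b ^+ d = f.[a] ->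
    d%:R * b ^+ d.-1 * (b ^+ q - b) = f^`().[a] * (a ^+ q - a).
Proof.
move=> HG a b eb; pose P (i : 'I_3) := nth 0 [:: a; b; 1] i.
have z0 : P o2 != 0 by rewrite oner_neq0.
have G0 : (y_pow_eq_form d f).@[P] = 0.
  by rewrite meval_form_affine // !divr1 eb subrr mulr0.
have [dx0|dx0] := eqVneq ((y_pow_eq_form d f)^`M(o0)).@[P] 0; last first.
  have /HG : nonsingular_point (y_pow_eq_form d f) P.
    by split=> //; [exists o2 | exists o0].
  move/(congr1 ( *%R (P o2))); rewrite /= mulr0 tangent_affine // !divr1 !expr1n !mul1r.
  by move/eqP; rewrite subr_eq0 => /eqP.
have [dy0|dy0] := eqVneq ((y_pow_eq_form d f)^`M(o1)).@[P] 0; last first.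
  have /HG : nonsingular_point (y_pow_eq_form d f) P.
    by split=> //; [exists o2 | exists o1].
  move/(congr1 ( *%R (P o2))); rewrite /= mulr0 tangent_affine // !divr1 !expr1n !mul1r.
  by move/eqP; rewrite subr_eq0 => /eqP.
move: (meval_form_dx_affine d f P z0) (meval_form_dy_affine d f P z0).
rewrite dx0 dy0 !divr1 !expr1n !mul1r => /esym/eqP; rewrite oppr_eq0 => /eqP-> <-.
by rewrite !mul0r.
Qed.

(** * Powers of homogenizations and reducibility of the curve *)

Definition homogenize (N : nat) (f : {poly K}) (x z : {mpoly K[3]}) : {mpoly K[3]} :=
  \sum_(i < size f) f`_i *: (x ^+ i * z ^+ (N - i)).

(** In the fraction field the homogenization is z^N f(x/z), which makes its compatibility with
    powers immediate; [tofrac] is injective. *)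
Lemma homogenizeX N w f x z : (size f <= N.+1)%N -> z != 0 ->
  homogenize (w * N) (f ^+ w) x z = homogenize N f x z ^+ w.
Proof.
move=> szf z0; apply/eqP; rewrite -tofrac_eq; apply/eqP.
pose phi : {rmorphism K -> {fraction {mpoly K[3]}}} := (@tofrac _) \o (@mpolyC 3 K).
have Z0 : tofrac z != 0 by rewrite tofrac_eq0.
have E M (g : {poly K}) : (size g <= M.+1)%N -> tofrac (homogenize M g x z) =
    tofrac z ^+ M * (map_poly phi g).[tofrac x / tofrac z].
  move=> szg; rewrite horner_coef size_map_poly mulr_sumr rmorph_sum.
  apply: eq_bigr => i _ /=; rewrite coef_map -mul_mpolyC !rmorphM !rmorphXn /=.
  by rewrite expf_sub // ?exprMn ?exprVn; [ring | rewrite -ltnS (leq_trans (ltn_ord i))].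
rewrite E; last first.
  have [->|w0] := posnP w; first by rewrite expr0 size_poly1.
  have [->|f0] := eqVneq f 0; first by rewrite expr0n gtn_eqF // size_poly0.
  rewrite -[size _]prednK ?size_poly_gt0 ?expf_neq0 // size_exp ltnS mulnC.
  by rewrite leq_mul // -ltnS prednK ?size_poly_gt0.
by rewrite tofracXn E // rmorphXn horner_exp exprMn -exprM (mulnC N).
Qed.
End Forms.

(** The form is A^w - B^w, hence divisible by A - B. At (a : 0 : 1) with g(a) = 0 both A and B
    vanish, so for w > 1 both factors vanish there and neither is a unit. *)
Lemma reducible_y_pow_eq_form (K : closedFieldType) d w (g : {poly K}) :
  (0 < d)%N -> (1 < size g)%N ->
  irreducible_mpoly (y_pow_eq_form (w * d) (g ^+ w)) -> (w <= 1)%N.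
Proof.
move=> d0 szg [_ _ irr]; rewrite leqNgt; apply/negP => w1.
pose N := maxn d (size g).-1.
pose x : {mpoly K[3]} := 'X_(@Ordinal 3 0 isT).
pose y : {mpoly K[3]} := 'X_(@Ordinal 3 1 isT).
pose z : {mpoly K[3]} := 'X_(@Ordinal 3 2 isT).
pose A := y ^+ d * z ^+ (N - d); pose B := homogenize K N g x z.
have z0 : z != 0.
  apply/eqP => /(congr1 (meval (fun=> 1))) /eqP.
  by rewrite mevalXU meval0 oner_eq0.
have GE : y_pow_eq_form (w * d) (g ^+ w) = A ^+ w - B ^+ w.
  rewrite /y_pow_eq_form size_exp -/x -/y -/z.
  have -> : maxn (w * d) ((size g).-1 * w) = (w * N)%N by rewrite [RHS]mulnC maxnMl mulnC.
  rewrite -homogenizeX //; last by rewrite (leq_trans (leqSpred _)) // ltnS leq_maxr.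
  by rewrite exprMn -!exprM -mulnBr !(mulnC w).
have [a ra] : exists a, root g a by apply/closed_rootP; rewrite neq_ltn szg orbT.
pose P (i : 'I_3) : K := nth 0 [:: a; 0; 1] i.
have A0 : A.@[P] = 0.
  by rewrite mevalM !rmorphXn /= mevalXU expr0n gtn_eqF // mul0r.
have B0 : B.@[P] = 0.
  move/rootP: ra; rewrite horner_coef => <-; rewrite /B /homogenize rmorph_sum.
  apply: eq_bigr => i _ /=.
  by rewrite mevalZ mevalM !rmorphXn /= !mevalXU expr1n mulr1.
have nunit (H : {mpoly K[3]}) : H.@[P] = 0 -> H \isn't a GRing.unit.
  by move=> H0; apply/negP => /(rmorph_unit (meval P)); rewrite /= H0 unitr0.
move: GE; rewrite subrXX => /irr[]; apply/negP/nunit.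
  by rewrite mevalB A0 B0 subrr.
rewrite rmorph_sum big1 // => i _ /=; rewrite mevalM !rmorphXn /= A0 B0.
(* For i = 0 the vanishing comes from A^(w-1), where w - 1 > 0; otherwise from B^i. *)
rewrite !expr0n; case: (nat_of_ord i) => [|k]; last by rewrite mulr0.
by rewrite subn0 mulr1 eqn0Ngt -ltnS (ltn_predK w1) w1.
Qed.

(** * The polynomial identity expressing tangency *)

Lemma poly_eq0_closed (K : closedFieldType) (f : {poly K}) :
  (forall a, f.[a] = 0) -> f = 0.
Proof.
by move=> f0; apply/eqP; apply: contraT => /closed_nonrootP[a]; rewrite /root f0 eqxx.
Qed.

Lemma closed_root_exists (K : closedFieldType) d (c : K) : (0 < d)%N ->
  exists b, b ^+ d = c.
Proof.
move=> d0; have /closed_rootP[b] : size ('X^d - c%:P) != 1%N.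
  by rewrite size_XnsubC // eqSS -lt0n.
by rewrite /root !hornerE subr_eq0 => /eqP; exists b.
Qed.

(** As d is nonzero in [K], X^d - 1 is separable and has d distinct roots, all of them roots of X^r
    - 1. *)
Lemma closed_unity_roots_leq (K : closedFieldType) d r :
  d%:R != 0 :> K -> (0 < r)%N ->
  (forall u : K, u ^+ d = 1 -> u ^+ r = 1) -> (d <= r)%N.
Proof.
move=> dK r0 dr; have d0 : (0 < d)%N by case: d dK {dr} => //; rewrite eqxx.
have [s sE] := closed_field_poly_normal ('X^d - 1 : {poly K}).
move: sE; rewrite lead_coefXnsubC // scale1r => sE.
have sep : separable_poly ('X^d - 1 : {poly K}) by rewrite separable_Xn_sub_1.
move: sep; rewrite sE separable_prod_XsubC => us.
have szs : size s = d.
  by have := size_XnsubC (1 : K) d0; rewrite sE size_prod_XsubC => -[].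
rewrite -szs -ltnS -(size_XnsubC (1 : K) r0); apply: max_poly_roots => //.
  by rewrite -size_poly_gt0 size_XnsubC.
apply/allP => u us'; rewrite /root !hornerE subr_eq0; apply/eqP/dr/eqP.
rewrite -subr_eq0; have : root (\prod_(v <- s) ('X - v%:P)) u by rewrite root_prod_XsubC.
by rewrite -sE /root !hornerE.
Qed.

(** Only exponents divisible by p survive, so each monomial is a p-th power, and Frobenius is
    additive on [{poly L}]. *)
Lemma deriv0_pth_power (L : fieldType) p (f : {poly L}) : p \in [pchar L] ->
  (forall c : L, exists b, b ^+ p = c) -> f^`() = 0 -> exists g, f = g ^+ p.
Proof.
move=> cp rt f'0; have cpX : p \in [pchar {poly L}] by rewrite pchar_poly.
have p0 : (0 < p)%N by rewrite prime_gt0 // (pcharf_prime cp).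
have /fin_all_exists[t tE] (j : 'I_(size f)) :
    exists t : {poly L}, f`_j *: 'X^j = pFrobenius_aut cpX t.
  have [pj|npj] := boolP (p %| j)%N.
    have [c cE] := rt f`_j; exists (c *: 'X^(j %/ p)).
    by rewrite pFrobenius_autE exprZn cE -exprM divnK.
  exists 0; rewrite rmorph0; suff -> : f`_j = 0 by rewrite scale0r.
  case: (nat_of_ord j) npj => [|k] npj; first by rewrite dvdn0 in npj.
  have := congr1 (fun h : {poly L} => h`_k) f'0.
  rewrite /= coef_deriv coef0 -mulr_natr => /eqP.
  by rewrite mulf_eq0 -(dvdn_pcharf cp) (negPf npj) orbF => /eqP.
exists (\sum_j t j); rewrite -(pFrobenius_autE cpX) rmorph_sum -{1}(coefK f) poly_def.
exact: eq_bigr.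
Qed.

Section TangentIdentity.
Variables (K : closedFieldType) (f : {poly K}) (d q : nat).
Hypotheses (d0 : (0 < d)%N) (q1 : (1 < q)%N) (sf : (1 < size f)%N).
Hypothesis tangent : forall a b, b ^+ d = f.[a] ->
  d%:R * b ^+ d.-1 * (b ^+ q - b) = f^`().[a] * (a ^+ q - a).

(** Every a has a point (a, b) above it, so the tangency relation makes f' (X^q - X) vanish on the
    infinite field [K]. *)
Lemma tangent_deriv0 : d%:R = 0 :> K -> f^`() = 0.
Proof.
move=> dK; have : f^`() * ('X^q - 'X) = 0.
  apply: poly_eq0_closed => a; have [b /tangent] := closed_root_exists K d f.[a] d0.
  by rewrite dK !mul0r !hornerE => <-.
move/eqP; rewrite mulf_eq0 => /orP[/eqP//|].
by rewrite -size_poly_eq0 size_polyDl ?size_polyXn // size_polyN size_polyX.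
Qed.

(* The tangency condition at [(a, b)] and [(a, u b)], [u ^+ d = 1], forces
   [u ^+ ((q - 1) %% d) = 1]. *)
Lemma tangent_dvd : d%:R != 0 :> K -> (d %| q - 1)%N.
Proof.
move=> dK; have [a fa] : exists a, ~~ root f a.
  by apply/closed_nonrootP; rewrite -size_poly_gt0 (ltnW sf).
have [b eb] := closed_root_exists K d f.[a] d0.
have b0 : b != 0.
  by apply: contraNneq fa => b0; rewrite /root -eb b0 expr0n gtn_eqF.
set t := ((q - 1) %/ d)%N; set r := ((q - 1) %% d)%N.
have tangent_r u : u ^+ d = 1 ->
    d%:R * f.[a] * (f.[a] ^+ t * (u * b) ^+ r - 1) = f^`().[a] * (a ^+ q - a).
  move=> ud; have ub : (u * b) ^+ d = f.[a] by rewrite exprMn ud mul1r.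
  rewrite -(tangent _ _ ub); move: (u * b) ub => c ec.
  have -> : c ^+ q = c * (f.[a] ^+ t * c ^+ r).
    rewrite -ec -exprM -exprD -exprS mulnC -divn_eq; congr (_ ^+ _); lia.
  have ec1 : f.[a] = c ^+ d.-1 * c by rewrite -exprSr prednK.
  by rewrite {1}ec1; ring.
rewrite /dvdn; case: posnP => // r0.
have /(closed_unity_roots_leq _ _ _ dK r0) : forall u : K, u ^+ d = 1 -> u ^+ r = 1.
  move=> u ud; have := tangent_r 1 (expr1n _ _); rewrite -(tangent_r u ud) mul1r.
  have dfa : d%:R * f.[a] != 0 by rewrite mulf_neq0.
  have fat : f.[a] ^+ t * b ^+ r != 0 by rewrite mulf_neq0 ?expf_neq0.
  move=> /(mulfI dfa)/addIr; rewrite exprMn mulrCA => E.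
  by apply: (mulIf fat); rewrite -E mul1r.
by rewrite leqNgt ltn_mod d0.
Qed.

(** With b^d = f(a), b^(d-1) (b^q - b) = f(a) (f(a)^t - 1) no longer involves b, so tangency becomes
    an identity between polynomials in a. *)
Lemma tangent_identity t : (d * t = q - 1)%N ->
  d%:R *: (f * (f ^+ t - 1)) = f^`() * ('X^q - 'X).
Proof.
move=> dt; apply/eqP; rewrite -subr_eq0; apply/eqP/poly_eq0_closed => a.
have [b eb] := closed_root_exists K d f.[a] d0.
have ebq : b ^+ q = b * f.[a] ^+ t.
  by rewrite -eb -exprM dt -exprS subn1 (ltn_predK q1).
have eb1 : f.[a] = b ^+ d.-1 * b by rewrite -exprSr prednK.
by rewrite !hornerE /= -(tangent _ _ eb) ebq {1}eb1; ring.
Qed.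

End TangentIdentity.

(** Modulo p^e - 1, p^n - 1 is congruent to p^r - 1 with r = n mod e, which is smaller than p^e - 1
    and nonzero unless r = 0. For e = 0 the divisor is 0, which forces n = 0. *)
Lemma dvdn_pred_exp p e n : (1 < p)%N -> (p ^ e - 1 %| p ^ n - 1)%N -> (e %| n)%N.
Proof.
move=> p1; have [->|e0] := posnP e.
  rewrite expn0 subnn dvd0n subn_eq0 => pn1; case: n pn1 => // n.
  by rewrite expnS; have := expn_gt0 p n; nia.
move=> dn; rewrite /dvdn; apply: contraTT dn; rewrite -lt0n => r0.
set r := (n %% e)%N in r0; have re : (r < e)%N by rewrite ltn_mod.
have pe : (p ^ r < p ^ e)%N by rewrite ltn_exp2l.
have pr : (1 < p ^ r)%N by rewrite -(expn0 p) ltn_exp2l.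
have -> : (p ^ n - 1 = p ^ r * (p ^ (e * (n %/ e)) - 1) + (p ^ r - 1))%N.
  rewrite {1}(divn_eq n e) expnD mulnC (mulnC _ e) -/r mulnBr muln1.
  by have := expn_gt0 p (e * (n %/ e)); nia.
rewrite dvdn_addr; first by rewrite gtnNdvd //; lia.
by rewrite dvdn_mull // expnM !subn1 dvdn_pred_predX.
Qed.

(* The two cases of a point at infinity, [deg f < d] and [deg f = d], are treated
   together: the coefficient of index [d] is [0] in the first one. *)
Lemma sum_exp0_top (K : fieldType) (f : {poly K}) d (h : nat -> K) :
  (size f <= d.+1)%N ->
  \sum_(i < size f) f`_i * (h i * 0 ^+ (d - i)) = f`_d * h d.
Proof.
move=> sf.
rewrite -(big_mkord xpredT (fun i => f`_i * (h i * 0 ^+ (d - i)))).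
rewrite (big_nat_widen _ _ _ _ _ sf) big_mkcond big_mkord big_ord_recr /=.
rewrite big1 => [|i _]; last first.
  case: ifP => // _; rewrite expr0n gtn_eqF ?mulr0 //.
  by rewrite subn_gt0.
rewrite add0r subnn expr0 mulr1.
by case: ltnP => // /(nth_default 0) ->; rewrite mul0r.
Qed.

(** * From the polynomial identity back to tangency, at affine points and at infinity *)

Section Nonclassical.
Variables (K : closedFieldType) (f : {poly K}) (d q N : nat).
Hypotheses (d0 : (0 < d)%N) (N1 : (1 < N)%N) (dN : (d * N = d.-1 + q)%N).
Hypotheses (dK : d%:R = 1 :> K) (sf : (size f <= d.+1)%N).
Hypothesis fE : f ^+ N - f = f^`() * ('X^q - 'X).

(** When deg f = d, this compares the coefficients of index dN = (d - 1) + q in [fE]: on the right,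
    X^q picks the coefficient of index d - 1 in f', which is the top coefficient of f since d = 1 in
    [K]. *)
Lemma top_coef_fixed : f`_d ^+ N = f`_d.
Proof.
have [sfd|sfd] := leqP (size f) d.
  by rewrite (nth_default _ sfd) expr0n gtn_eqF // ltnW.
have szf : size f = d.+1 by apply/eqP; rewrite eqn_leq sf.
have lf : f`_d = lead_coef f by rewrite lead_coefE szf.
have szfN : size (f ^+ N) = (d * N).+1.
  rewrite -[LHS]prednK ?size_exp ?szf // size_poly_gt0 expf_neq0 //.
  by rewrite -size_poly_gt0 szf.
have := congr1 (fun g : {poly K} => g`_(d * N)) fE; rewrite /= coefB mulrBr coefB.
rewrite (_ : (f ^+ N)`_(d * N) = f`_d ^+ N); last first.
  by rewrite lf -lead_coef_exp lead_coefE szfN.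
rewrite (nth_default 0 (_ : (size f <= d * N)%N)) ?szf; last by nia.
rewrite subr0 => ->; rewrite coefMXn coefMX {1}dN ltnNge leq_addl /= dN addnK.
rewrite coef_deriv prednK // -[_ *+ d]mulr_natr dK mulr1.
(* The X part of X^q - X contributes the coefficient of f' of index dN - 1, which is 0 because f'
   has size at most d <= dN - 1. *)
case: eqP => [|_]; first by rewrite subr0.
have f0 : f != 0 by rewrite -size_poly_gt0 szf.
have /leq_trans szd : (size f^`() <= d)%N by rewrite -ltnS -szf lt_size_deriv.
by rewrite (nth_default 0 (szd _ _)) ?subr0 // -dN; nia.
Qed.

Lemma identity_on_tangent P :
  nonsingular_point (y_pow_eq_form d f) P ->
  on_tangent_line (y_pow_eq_form d f) P (fun i => P i ^+ q).
Proof.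
case=> _ G0 _; rewrite /on_tangent_line.
have q0 : (0 < q)%N by nia.
have maxd : maxn d (size f).-1 = d by apply/maxn_idPl; lia.
have powd (b : K) : b ^+ d.-1 * b ^+ q = (b ^+ d) ^+ N by rewrite -exprD -dN exprM.
(* At an affine point (a, b), b^(d-1) (b^q - b) = b^(dN) - b^d = f(a)^N - f(a), so tangency is [fE]
   evaluated at a. *)
have [z0|z0] := eqVneq (P (@Ordinal 3 2 isT)) 0; last first.
  apply: (mulfI z0); rewrite mulr0 tangent_affine // dK mul1r.
  move: G0; rewrite meval_form_affine // => /eqP.
  rewrite mulf_eq0 expf_eq0 (negPf z0) andbF /= subr_eq0 => /eqP eb.
  have := congr1 (horner^~ (P (@Ordinal 3 0 isT) / P (@Ordinal 3 2 isT))) fE.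
  rewrite /= !hornerE => <-; rewrite [_ ^+ d.-1 * (_ - _)]mulrBr powd -exprSr prednK //.
  by rewrite eb subrr mulr0.
(* At infinity, with c the coefficient of index d, the curve reads y^d = c x^d and tangency reads
   y^(dN) = c x^(dN), which follows from c^N = c. *)
rewrite sum_ord3 meval_form_dx meval_form_dy z0 [X in _ + _ + _ * X]expr0n.
rewrite maxd subnn expr0 (gtn_eqF q0) mulr0 addr0 mulr1 dK mul1r powd.
rewrite (sum_exp0_top _ _ _ (fun i => i%:R * _ ^+ i.-1) sf) dK mul1r.
move: G0; rewrite meval_form z0 maxd subnn expr0 mulr1.
rewrite (sum_exp0_top _ _ _ (fun i => _ ^+ i) sf) => /eqP.
rewrite subr_eq0 => /eqP->; rewrite exprMn top_coef_fixed -powd; ring.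
Qed.

End Nonclassical.

(** * The two implications *)

Lemma nonclassical_imp_MVSP (HC : condition_C)
    (F : finFieldType) (p n : nat) (p_prime : prime p)
    (card_F : #|F| = (p ^ n)%N)
    (K : closedFieldType) (iota : {rmorphism F -> K})
    (d : nat) (d_gt0 : (0 < d)%N)
    (f : {poly F}) (f_nonconstant : (1 < size f)%N)
    (curve_irr : irreducible_mpoly (map_mpoly iota (y_pow_eq_form d f)))
    (d_lt : (d < #|F| - 1)%N) :
  Frobenius_nonclassical iota (y_pow_eq_form d f) ->
  exists e : nat,
    [/\ (e %| n)%N,
        d = ((#|F| - 1) %/ (p ^ e - 1))%N,
        is_MVSP f &
        is_subfield_of_order (p ^ e) (value_set f)].
Proof.
rewrite /Frobenius_nonclassical y_pow_eq_form_map in curve_irr *.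
move=> /on_curve_tangent tangent.
have sfK : (1 < size (map_poly iota f))%N by rewrite size_map_poly.
have q1 := @finField_card_gt1 F.
have irr_power w d' (g : {poly F}) :
    (0 < d')%N -> d = (w * d')%N -> f = g ^+ w -> (1 < size g)%N -> (w <= 1)%N.
  move=> d'0 dE fE sg; move: curve_irr; rewrite dE fE rmorphXn /=.
  by apply: reducible_y_pow_eq_form; rewrite ?size_map_poly.
have p_char : p \in [pchar F] := card_finPcharP card_F p_prime.
(* If p divided d, then f' = 0 would make [f] a p-th power too, and [irr_power] would apply with w =
   p. *)
have dF : d%:R != 0 :> F.
  apply/eqP => dF.
  have dK : d%:R = 0 :> K by rewrite -(rmorph_nat iota) dF rmorph0.
  have f'0 : f^`() = 0.
    apply: (map_poly_inj iota); rewrite -deriv_map map_poly0.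
    exact: (tangent_deriv0 _ _ _ _ d_gt0 q1 tangent).
  have n0 : (0 < n)%N by move: q1; rewrite card_F; case: (n).
  (* The p-th root of c is c^(q/p), because c^q = c. *)
  have pth (c : F) : exists b, b ^+ p = c.
    by exists (c ^+ (p ^ n.-1)); rewrite -exprM -expnSr prednK // -card_F expf_card.
  have [g fE] := deriv0_pth_power _ _ _ p_char pth f'0.
  have /dvdnP[d' dE] : (p %| d)%N by rewrite (dvdn_pcharf p_char) dF.
  suff : (p <= 1)%N by rewrite leqNgt prime_gt1.
  apply: (irr_power p d' g) => //.
  - by case: d' dE d_gt0 => [->|].
  - by rewrite mulnC.
  - rewrite ltnNge; apply: contraL f_nonconstant => /size1_polyC gE.
    by rewrite fE gE -rmorphXn size_polyC -leqNgt leq_b1.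
have dK : d%:R != 0 :> K by rewrite -(rmorph_nat iota) fmorph_eq0.
have /dvdnP[t tE] := tangent_dvd _ _ _ _ d_gt0 q1 sfK tangent dK.
have dt : (d * t = #|F| - 1)%N by rewrite mulnC.
(* This is where d < q - 1 enters: it excludes t = 1. *)
have t1 : (1 < t)%N by move: d_lt; rewrite tE; case: (t) => [|[|]] //; rewrite mul1n ltnn.
have fE : d%:R *: (f * (f ^+ t - 1)) = f^`() * ('X^#|F| - 'X).
  apply: (map_poly_inj iota); rewrite map_polyZ !rmorphM !rmorphB !rmorphXn /=.
  rewrite map_polyX rmorph1 rmorph_nat -deriv_map.
  exact: (tangent_identity _ _ _ _ d_gt0 q1 tangent _ dt).
have [mf ct] := MVSP_of_identity f_nonconstant (ltnW t1) dt dF fE.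
have [e [g [w [mg gE fg dw /dvdnP[d' d'E]]]]] :=
  power_of_MVSP_subfield HC p_prime card_F t1 dt f_nonconstant mf ct.
have pe1 : (0 < p ^ e - 1)%N.
  by rewrite lt0n; apply/eqP => pe0; move: d'E; rewrite pe0; lia.
have dE : d = (w * d')%N.
  by apply/eqP; rewrite -(eqn_pmul2r pe1) dw d'E mulnA.
have d'0 : (0 < d')%N by case: d' dE d_gt0 {d'E} => [->|//]; rewrite muln0.
have w1 : w = 1%N.
  apply/eqP; rewrite eqn_leq (irr_power w d' g) //; last by case: mg.
  by case: w dE d_gt0 {fg dw} => [->|].
move: fg; rewrite w1 expr1 => ->; exists e; split=> //.
  by apply: (dvdn_pred_exp p) (prime_gt1 p_prime) _; rewrite -card_F d'E dvdn_mull.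
by rewrite d'E mulnK // dE w1 mul1n.
Qed.

Lemma MVSP_imp_nonclassical
    (F : finFieldType) (p n : nat) (p_prime : prime p)
    (card_F : #|F| = (p ^ n)%N)
    (K : closedFieldType) (iota : {rmorphism F -> K})
    (d e : nat) (d_gt0 : (0 < d)%N) (f : {poly F}) :
  (e %| n)%N -> d = ((#|F| - 1) %/ (p ^ e - 1))%N -> is_MVSP f ->
  is_subfield_of_order (p ^ e) (value_set f) ->
  Frobenius_nonclassical iota (y_pow_eq_form d f).
Proof.
move=> /dvdnP[k nE] dE mf [fV cV]; rewrite /Frobenius_nonclassical y_pow_eq_form_map.
have q1 := @finField_card_gt1 F.
have N1 : (1 < p ^ e)%N by rewrite -cV subfield_card_gt1.
have pe1 : (0 < p ^ e - 1)%N by rewrite subn_gt0.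
have dN : (d * (p ^ e - 1) = #|F| - 1)%N.
  by rewrite dE divnK // card_F nE mulnC expnM !subn1 dvdn_pred_predX.
have p_char : p \in [pchar F] := card_finPcharP card_F p_prime.
have pow0 m : (1 < p ^ m)%N -> (p ^ m)%:R = 0 :> F.
  by case: m => // m _; rewrite natrX (pcharf0 p_char) expr0n.
have dF : d%:R = 1 :> F.
  (* Reading d (p^e - 1) = q - 1 in [F] gives -d = -1. *)
  have := congr1 (fun m => m%:R : F) dN; rewrite /= card_F natrM !natrB //.
  - by rewrite !pow0 -?card_F // sub0r mulrN1 => /oppr_inj.
  - by rewrite -card_F ltnW.
  - exact: ltnW.
have fE := MVSP_subfield_identity p_prime card_F mf fV; rewrite cV in fE.
(* Minimality gives (p^e - 1) deg f <= q - 1 = d (p^e - 1), hence deg f <= d, so the form has degree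
   d. *)
have degf := MVSP_subfield_degree mf; rewrite cV -dN mulnC leq_pmul2r // in degf.
apply: (@identity_on_tangent _ _ _ _ (p ^ e)%N) => //.
- by nia.
- by rewrite -(rmorph_nat iota) dF rmorph1.
- by rewrite size_map_poly -(leq_add2r 0) !addn0 (leq_trans (leqSpred _)).
- have := congr1 (map_poly iota) fE.
  by rewrite !(rmorphB, rmorphM, rmorphXn) /= map_polyX -deriv_map.
Qed.

Theorem theorem2p8 (HC : condition_C)
    (F : finFieldType) (p n : nat) (p_prime : prime p)
    (card_F : #|F| = (p ^ n)%N)
    (K : closedFieldType) (iota : {rmorphism F -> K})
    (K_alg : forall x : K, algebraicOver iota x)
    (d : nat) (d_gt0 : (0 < d)%N)
    (f : {poly F}) (f_nonconstant : (1 < size f)%N)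
    (curve_irr : irreducible_mpoly (map_mpoly iota (y_pow_eq_form d f)))
    (d_lt : (d < #|F| - 1)%N) :
  Frobenius_nonclassical iota (y_pow_eq_form d f) <->
  exists e : nat,
    [/\ (e %| n)%N,
        d = ((#|F| - 1) %/ (p ^ e - 1))%N,
        is_MVSP f &
        is_subfield_of_order (p ^ e) (value_set f)].
Proof.
split=> [|[e [en dE mf fV]]]; first exact: nonclassical_imp_MVSP.
exact: (MVSP_imp_nonclassical F p n p_prime card_F K iota d e).
Qed.
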